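(* Suppose that $u_D\in H^{\frac12}(\Gamma_D^u;\mathbb{R}^d)$ and $\Theta\in L^2(\Omega)$ are given and do not depend on $t$. If $u(x,t)$ and $z(x,t)$ are sufficiently smooth and satisfy $$-\operatorname{div}\big((1-z)^2\sigma^*[u,\Theta]\big)=0\quad\text{in }\Omega\times[0,T],$$ $$\alpha\frac{\partial z}{\partial t}=\Big(\epsilon\operatorname{div}(\gamma_*\nabla z)-\frac{\gamma_*}{\epsilon}z+(1-z)W^*(u,\Theta)\Big)_+\quad\text{in }\Omega\times[0,T],$$ $$u=u_D\ \text{ on }\Gamma_D^u\times[0,T],\qquad \sigma^*[u,\Theta]n=0\ \text{ on }\Gamma_N^u\times[0,T],\qquad \frac{\partial z}{\partial n}=0\ \text{ on }\Gamma\times[0,T],\qquad z(\cdot,0)=z_*\ \text{ in }\Omega,$$ then the following energy equality holds: $$\frac{d}{dt}\Big(\mathcal{E}_{el}^*(u(t),\Theta,z(t))+E_s(z(t))\Big)=-\alpha\int_\Omega|\dot z|^2\,dx\le0 .$$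
   Context: $\Omega\subset\mathbb{R}^d$ ($d=2$ or $3$) is a bounded domain with boundary $\Gamma=\partial\Omega$ and outward unit normal $n$; $\Gamma=\Gamma_D^u\cup\Gamma_N^u$ with $\Gamma_D^u\cap\Gamma_N^u=\emptyset$, the $(d-1)$-dimensional volume of $\Gamma_D^u$ being positive; $T>0$. $H^{\frac12}(\Gamma_D^u;\mathbb{R}^d)$ is the trace space on $\Gamma_D^u$ of $H^1(\Omega;\mathbb{R}^d)$. The unknowns are the displacement $u:\overline\Omega\times[0,T]\to\mathbb{R}^d$ and the damage variable $z:\overline\Omega\times[0,T]\to[0,1]$; $z_*$ is the initial damage; $\dot z=\partial z/\partial t$; $u(t)=u(\cdot,t)$, $z(t)=z(\cdot,t)$; $(s)_+:=\max(s,0)$. Constants: Lam\'e constants $\mu>0$, $\lambda>-\frac{2\mu}{d}$; $a_L>0$; $\beta:=a_L(d\lambda+2\mu)$; reference temperature $\Theta_0>0$; regularization parameters $\alpha>0$, $\epsilon>0$; critical energy release rate $\gamma_*>0$ (constant). Strain and stress: $e[u]_{ij}=\frac12(\partial_{x_j}u_i+\partial_{x_i}u_j)$; $\sigma[u]:=\lambda(\operatorname{div}u)I+2\mu e[u]$; $e^*[u,\Theta]:=e[u]-a_L(\Theta-\Theta_0)I$; $\sigma^*[u,\Theta]:=\sigma[u]-\beta(\Theta-\Theta_0)I$, with $I$ the $d\times d$ identity; $A:B=\sum_{i,j}A_{ij}B_{ij}$; the divergence of a matrix field is row-wise. $W^*(u,\Theta):=\sigma^*[u,\Theta]:e^*[u,\Theta]$.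 Energies: $$\mathcal{E}_{el}^*(u,\Theta,z):=\frac12\int_\Omega(1-z)^2\sigma^*[u,\Theta]:e^*[u,\Theta]\,dx,\qquad E_s(z):=\frac12\int_\Omega\gamma_*\Big(\epsilon|\nabla z|^2+\frac{|z|^2}{\epsilon}\Big)dx .$$ ''Sufficiently smooth'' means regular enough (including the boundary of the domain) that all expressions make sense, one may differentiate under the integral sign in time, and Green's formula is valid for the fields involved. *)

(* Defs.v *)
From HB Require Import structures.
From mathcomp Require Import all_boot all_order all_algebra.
From mathcomp Require Import all_classical all_reals all_analysis.

Set Implicit Arguments.
Unset Strict Implicit.
Unset Printing Implicit Defensive.

Import Order.TTheory GRing.Theory Num.Theory.
Import numFieldNormedType.Exports.

Local Open Scope classical_set_scope.
Local Open Scope ring_scope.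

(* Euclidean structure on R^d.  The norm `|x| of the library on 'rV[R]_d is the
   sup norm; it gives the same topology, but the Hausdorff measure and unit
   vectors need the Euclidean one. *)

Definition dot (R : realType) (d : nat) (x y : 'rV[R]_d) : R :=
  \sum_j x 0 j * y 0 j.

Definition enorm (R : realType) (d : nat) (x : 'rV[R]_d) : R :=
  Num.sqrt (dot x x).

(* Lebesgue measure on R^d and k-dimensional Hausdorff measure, obtained from
   outer measures by Caratheodory's construction.  [all_sets T] is T with every
   subset measurable, so that [mu_ext] ranges over all countable covers. *)

Definition all_sets (T : Type) : Type := T.

HB.instance Definition _ (T : pointedType) := Pointed.on (all_sets T).
HB.instance Definition _ (T : pointedType) :=
  @isMeasurable.Build default_measure_display (all_sets T) discrete_measurable
    discrete_measurable0 discrete_measurableC discrete_measurableU.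

Section gauge_outer_measure.
Context (R : realType) (T : pointedType).
Local Open Scope ereal_scope.

Definition gauge0 (c : set T -> \bar R) (A : set T) : \bar R :=
  if pselect (A = set0) then 0 else c A.

(* Infimum of \sum_k c (F k) over the countable covers F of the set, where
   empty members of the cover count for 0. *)
Definition gauge_outer (c : set T -> \bar R) : set T -> \bar R :=
  mu_ext (gauge0 c : set (all_sets T) -> \bar R).

Variable c : set T -> \bar R.
Hypothesis c_ge0 : forall A, 0 <= c A.

Lemma gauge00 : gauge0 c set0 = 0.
Proof. by rewrite /gauge0; case: pselect => /= *. Qed.

Lemma gauge0_ge0 A : 0 <= gauge0 c A.
Proof. by rewrite /gauge0; case: pselect => /= *. Qed.

Lemma gauge_outer0 : gauge_outer c set0 = 0.
Proof. exact: (@mu_ext0 _ (all_sets T) R (gauge0 c) gauge00 gauge0_ge0). Qed.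

Lemma gauge_outer_ge0 A : 0 <= gauge_outer c A.
Proof. exact: (@mu_ext_ge0 _ (all_sets T) R (gauge0 c) gauge0_ge0). Qed.

Lemma le_gauge_outer : {homo gauge_outer c : A B / A `<=` B >-> A <= B}.
Proof. exact: (@le_mu_ext _ (all_sets T) R (gauge0 c)). Qed.

Lemma gauge_outer_sigma_subadditive : sigma_subadditive (gauge_outer c).
Proof. exact: (@mu_ext_sigma_subadditive _ (all_sets T) R (gauge0 c) gauge0_ge0). Qed.

End gauge_outer_measure.

Section lebesgue.
Context (R : realType) (d : nat).
Local Open Scope ereal_scope.

Definition box (a b : 'rV[R]_d) : set 'rV[R]_d :=
  [set x | forall i, (a 0 i < x 0 i <= b 0 i)%R].

Definition box_gauge (A : set 'rV[R]_d) : \bar R :=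
  ereal_inf [set v | exists a b : 'rV[R]_d,
    [/\ forall i, (a 0 i <= b 0 i)%R, A `<=` box a b &
        v = (\prod_i (b 0 i - a 0 i)%R)%:E]].

Definition lebesgue_outer : set 'rV[R]_d -> \bar R := gauge_outer box_gauge.

Lemma box_gauge_ge0 A : 0 <= box_gauge A.
Proof.
apply: le_ereal_inf_tmp => _ [a [b [ab _ ->]]].
by rewrite lee_fin; apply: prodr_ge0 => i _; rewrite subr_ge0.
Qed.

HB.instance Definition _ := isOuterMeasure.Build R 'rV[R]_d lebesgue_outer
  (gauge_outer0 box_gauge_ge0) (gauge_outer_ge0 box_gauge_ge0)
  (@le_gauge_outer _ _ box_gauge)
  (gauge_outer_sigma_subadditive box_gauge_ge0).

Let om : {outer_measure set 'rV[R]_d -> \bar R} := lebesgue_outer.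

Definition Leb : {measure set (caratheodory_type om) -> \bar R} :=
  [the measure _ _ of (om : set (caratheodory_type om) -> \bar R)].

End lebesgue.
Arguments Leb {R d}.

(* Volume of the unit ball of R^k. *)
Fixpoint ball_vol (R : realType) (k : nat) : R :=
  match k with
  | 0 => 1
  | 1 => 2
  | S (S k' as k1) => 2 * pi / k1.+1%:R * ball_vol R k'
  end.

Section hausdorff.
Context (R : realType) (d k : nat).
Local Open Scope ereal_scope.

(* ball_vol k * (diam A / 2)^k if diam A <= delta, and +oo otherwise; with this
   normalization the measure is the surface measure on C^1 hypersurfaces. *)
Definition diam_gauge (delta : R) (A : set 'rV[R]_d) : \bar R :=
  ereal_inf [set v | exists r : R,
    [/\ (0 <= r <= delta)%R,
        forall x y, A x -> A y -> (enorm (x - y) <= r)%R &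
        v = (ball_vol R k * (r / 2) ^+ k)%:E]].

Definition hausdorff_outer (A : set 'rV[R]_d) : \bar R :=
  ereal_sup [set gauge_outer (diam_gauge delta) A |
             delta in [set delta : R | (0 < delta)%R]].

Lemma ball_vol_ge0 (m : nat) : (0 <= ball_vol R m)%R.
Proof.
suff : (0 <= ball_vol R m)%R /\ (0 <= ball_vol R m.+1)%R by case.
elim: m => [|m [h0 h1]]; first by split => //=.
split=> //=; apply: mulr_ge0 => //; apply: divr_ge0 => //.
by rewrite mulr_ge0// pi_ge0.
Qed.

Lemma diam_gauge_ge0 delta A : 0 <= diam_gauge delta A.
Proof.
apply: le_ereal_inf_tmp => _ [r [/andP[r0 _] _ ->]].
by rewrite lee_fin mulr_ge0 ?ball_vol_ge0// exprn_ge0// divr_ge0.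
Qed.

Lemma hausdorff_outer0 : hausdorff_outer set0 = 0.
Proof.
rewrite /hausdorff_outer (_ : [set _ | _ in _] = [set 0]) ?ereal_sup1//.
apply/seteqP; split=> [_ [delta _ <-]|_ ->].
  by rewrite (gauge_outer0 (diam_gauge_ge0 delta)).
by exists 1%R; rewrite /= ?ltr01// (gauge_outer0 (diam_gauge_ge0 _)).
Qed.

Lemma hausdorff_outer_ge0 A : 0 <= hausdorff_outer A.
Proof.
apply: le_trans (gauge_outer_ge0 (diam_gauge_ge0 1) A) _.
by apply: ereal_sup_ubound; exists 1%R => //=; rewrite ltr01.
Qed.

Lemma le_hausdorff_outer :
  {homo hausdorff_outer : A B / A `<=` B >-> A <= B}.
Proof.
move=> A B AB; apply: ge_ereal_sup => _ [delta delta0 <-].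
apply: le_trans (le_gauge_outer (diam_gauge delta) AB) _.
by apply: ereal_sup_ubound; exists delta.
Qed.

Lemma hausdorff_outer_sigma_subadditive : sigma_subadditive hausdorff_outer.
Proof.
move=> F; apply: ge_ereal_sup => _ [delta delta0 <-].
apply: le_trans
  (gauge_outer_sigma_subadditive (diam_gauge_ge0 delta) F) _.
apply: lee_nneseries => i _; first by move=> _; exact/gauge_outer_ge0/diam_gauge_ge0.
by apply: ereal_sup_ubound; exists delta.
Qed.

HB.instance Definition _ := isOuterMeasure.Build R 'rV[R]_d hausdorff_outer
  hausdorff_outer0 hausdorff_outer_ge0 le_hausdorff_outer
  hausdorff_outer_sigma_subadditive.

Let om : {outer_measure set 'rV[R]_d -> \bar R} := hausdorff_outer.

Definition Haus : {measure set (caratheodory_type om) -> \bar R} :=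
  [the measure _ _ of (om : set (caratheodory_type om) -> \bar R)].

End hausdorff.
Arguments Haus {R d}.

Definition Surf (R : realType) (d : nat) := @Haus R d d.-1.
Arguments Surf {R d}.

Section domains.
Context (R : realType) (d : nat).
Implicit Types (Om G : set 'rV[R]_d) (x n nu : 'rV[R]_d).

Definition bounded_domain Om :=
  [/\ open Om, connected Om, Om !=set0 & bounded_set Om].

Definition boundary (A : set 'rV[R]_d) := closure A `\` interior A.

(* nu is a unit vector and, near x, Om coincides with the half-space
   (y - x) . nu < 0 outside of arbitrarily flat double cones. *)
Definition outward_unit_normal Om x nu :=
  enorm nu = 1 /\
  forall e : R, 0 < e -> \forall y \near x,
    (dot (y - x) nu < - e * enorm (y - x) -> Om y) /\
    (e * enorm (y - x) < dot (y - x) nu -> ~ closure Om y).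

End domains.

Section differential_operators.
Context (R : realType) (d : nat).
Implicit Types (f v : 'rV[R]_d -> R) (F w n : 'rV[R]_d -> 'rV[R]_d)
  (S : 'rV[R]_d -> 'M[R]_d) (x : 'rV[R]_d).

Definition basis_vec (j : 'I_d) : 'rV[R]_d := delta_mx 0 j.

Definition pder j f x : R := 'D_(basis_vec j) f x.

Definition grad f x : 'rV[R]_d := \row_j pder j f x.

Definition grad_vec w x : 'M[R]_d := \matrix_(i, j) pder j (fun y => w y 0 i) x.

Definition divergence F x : R := \sum_j pder j (fun y => F y 0 j) x.

Definition row_divergence S x : 'rV[R]_d :=
  \row_i divergence (fun y => row i (S y)) x.

(* Boundary values are limits from inside Om. *)
Definition normal_trace (Om : set 'rV[R]_d) n F x : R :=
  lim (dot (F y) (n x) @[y --> within Om (nbhs x)]).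

Definition Green_formula (Om : set 'rV[R]_d) n F v :=
  [/\ Leb.-integrable Om
        (fun x => (divergence F x * v x + dot (F x) (grad v x))%:E),
      {ae Surf, forall x, boundary Om x ->
        cvg (dot (F y) (n x) @[y --> within Om (nbhs x)])},
      Surf.-integrable (boundary Om) (fun x => (v x * normal_trace Om n F x)%:E) &
      \int[Leb]_(x in Om) (divergence F x * v x + dot (F x) (grad v x)) =
      \int[Surf]_(x in boundary Om) (v x * normal_trace Om n F x)].

End differential_operators.

Section sobolev.
Context (R : realType) (d : nat).
Implicit Types (Om G : set 'rV[R]_d) (f g w phi : 'rV[R]_d -> R).

Definition in_L2 (disp : measure_display) (T : measurableType disp)
    (mu : {measure set T -> \bar R}) (D : set T) (f : T -> R) : Prop :=
  f \_ D \in Lfun mu 2%:E.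

Definition smooth phi := forall s : seq 'I_d,
  let Dphi := foldr (@pder R d) phi s in
  continuous Dphi /\ forall j x, derivable Dphi x (basis_vec R j).

Definition test_function Om phi := smooth phi /\
  exists K : set 'rV[R]_d,
    [/\ compact K, K `<=` Om & forall x, ~ K x -> phi x = 0].

Definition weak_grad Om w (Dw : 'I_d -> 'rV[R]_d -> R) :=
  forall j phi, test_function Om phi ->
    \int[Leb]_(x in Om) (w x * pder j phi x) =
    - \int[Leb]_(x in Om) (Dw j x * phi x).

(* g is the trace on G of some w in H^1(Om), the trace operator being the
   continuous extension of the restriction of smooth functions. *)
Definition in_H12 Om G g :=
  in_L2 Surf G g /\
  exists (w : 'rV[R]_d -> R) (Dw : 'I_d -> 'rV[R]_d -> R)
         (phi : nat -> 'rV[R]_d -> R),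
    [/\ in_L2 Leb Om w,
        forall j, in_L2 Leb Om (Dw j),
        weak_grad Om w Dw &
        [/\ forall k, smooth (phi k),
            (\int[Leb]_(x in Om) ((phi k x - w x) ^+ 2)%:E)%E @[k --> \oo] --> 0%E,
            forall j, (\int[Leb]_(x in Om) ((pder j (phi k) x - Dw j x) ^+ 2)%:E)%E
              @[k --> \oo] --> 0%E &
            (\int[Surf]_(x in G) ((phi k x - g x) ^+ 2)%:E)%E
              @[k --> \oo] --> 0%E]].

End sobolev.

(* Derivatives with respect to t in [0, T]; they are one-sided at 0 and T. *)
Section time_derivative.
Context (R : realType) (T : R).
Implicit Types (f : R -> R) (t : R).

Definition time_quot f t (s : R) : R := (s - t)^-1 * (f s - f t).

Definition is_tder f t (l : R) :=
  time_quot f t s @[s --> within `[0, T] t^'] --> l.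

Definition tderivable f t := cvg (time_quot f t s @[s --> within `[0, T] t^']).

Definition tder f t : R := lim (time_quot f t s @[s --> within `[0, T] t^']).

End time_derivative.

Section thermoelasticity.
Context (R : realType) (d : nat).
Variables (mu lambda aL Theta0 : R) (Theta : 'rV[R]_d -> R).
Implicit Types (w : 'rV[R]_d -> 'rV[R]_d) (x : 'rV[R]_d) (z : 'rV[R]_d -> R).

Definition ddot (A B : 'M[R]_d) : R := \sum_i \sum_j A i j * B i j.

Definition beta : R := aL * (d%:R * lambda + 2 * mu).

Definition strain w x : 'M[R]_d := 2^-1 *: (grad_vec w x + (grad_vec w x)^T).

Definition stress w x : 'M[R]_d :=
  (lambda * divergence w x) *: 1%:M + (2 * mu) *: strain w x.

Definition strain_star w x : 'M[R]_d :=
  strain w x - (aL * (Theta x - Theta0)) *: 1%:M.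

Definition stress_star w x : 'M[R]_d :=
  stress w x - (beta * (Theta x - Theta0)) *: 1%:M.

Definition W_star w x : R := ddot (stress_star w x) (strain_star w x).

Definition degraded_stress w z x : 'M[R]_d := (1 - z x) ^+ 2 *: stress_star w x.

Definition E_el (Om : set 'rV[R]_d) w z : R :=
  2^-1 * \int[Leb]_(x in Om)
    ((1 - z x) ^+ 2 * ddot (stress_star w x) (strain_star w x)).

Definition E_s (Om : set 'rV[R]_d) (gamma eps : R) z : R :=
  2^-1 * \int[Leb]_(x in Om)
    (gamma * (eps * enorm (grad z x) ^+ 2 + `|z x| ^+ 2 / eps)).

End thermoelasticity.

Section smoothness.
Context (R : realType) (d : nat) (Om : set 'rV[R]_d) (T : R).
Implicit Types (f g : 'rV[R]_d -> R -> R).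

Definition cylinder : set ('rV[R]_d * R) := closure Om `*` `[0, T].

(* g, considered on Om x [0, T] only, extends continuously to the closure. *)
Definition cont_up_to_boundary g := exists2 h : 'rV[R]_d * R -> R,
  {within cylinder, continuous h} &
  forall x t, Om x -> t \in `[0, T] -> h (x, t) = g x t.

(* f, its first-order space derivatives, and the time derivatives of these
   functions exist and are continuous on the closed cylinder. *)
Definition C1_field f :=
  [/\ {within cylinder, continuous (fun p => f p.1 p.2)},
      forall x t, closure Om x -> t \in `[0, T] -> tderivable T (f x) t,
      {within cylinder, continuous (fun p => tder T (f p.1) p.2)} &
      forall j,
        [/\ forall x t, Om x -> t \in `[0, T] ->
              derivable (f^~ t) x (basis_vec R j),
            cont_up_to_boundary (fun x t => pder j (f^~ t) x),
            forall x t, Om x -> t \in `[0, T] ->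
              tderivable T (fun s => pder j (f^~ s) x) t &
            cont_up_to_boundary
              (fun x t => tder T (fun s => pder j (f^~ s) x) t)]].

(* Regularity of a solution (u, z): the first clause makes the energies
   differentiable under the integral sign when Theta is in L^2, the second one
   gives a meaning to the divergences in the equations, and the last one is
   Green's formula for the fluxes of the two equations, tested with the time
   derivatives of the unknowns. *)
Definition sufficiently_smooth (n : 'rV[R]_d -> 'rV[R]_d)
    (mu lambda aL Theta0 gamma : R) (Theta : 'rV[R]_d -> R)
    (u : 'rV[R]_d -> R -> 'rV[R]_d) (z : 'rV[R]_d -> R -> R) :=
  let S t x := degraded_stress mu lambda aL Theta0 Theta (u^~ t) (z^~ t) x in
  let q t x := gamma *: grad (z^~ t) x in
  [/\ (forall i, C1_field (fun x t => u x t 0 i)) /\ C1_field z,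
      forall t x j, t \in `[0, T] -> Om x ->
        (forall i, derivable (fun y => S t y i j) x (basis_vec R j)) /\
        derivable (fun y => q t y 0 j) x (basis_vec R j) &
      forall t, t \in `[0, T] ->
        (forall i, Green_formula Om n (fun x => row i (S t x))
           (fun x => tder T (fun s => u x s 0 i) t)) /\
        Green_formula Om n (q t) (fun x => tder T (z x) t)].

End smoothness.

(* Main.v *)
Require Import Defs.
From HB Require Import structures.
From mathcomp Require Import all_boot all_order all_algebra.
From mathcomp Require Import all_classical all_reals all_analysis.
From mathcomp Require Import measurable_realfun ring lra.

Set Implicit Arguments.
Unset Strict Implicit.
Unset Printing Implicit Defensive.

Import Order.TTheory GRing.Theory Num.Theory.
Import numFieldNormedType.Exports.

Local Open Scope classical_set_scope.
Local Open Scope ring_scope.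

(** The rate of the total energy is computed by differentiating under the
    integral sign. At every point of the domain the rate of the energy density
    is
      [- (1 - z) v W + S : grad u' + eps q . grad v + (gamma / eps) z v],
    where [v] and [u'] are the time derivatives of [z] and [u], [S] is the
    degraded stress, [W] the elastic energy and [q = gamma grad z]. Green's
    formula moves the space derivatives from [u'] and [v] onto [S] and [q]. The
    boundary terms vanish: [u'] is zero on the Dirichlet part because the
    Dirichlet data are stationary, [S n] is zero on the Neumann part, and
    [q . n] is zero everywhere. Since [div S] is zero, there remains [- X v]
    with [X = eps div q - (gamma / eps) z + (1 - z) W], and the damage equation
    [alpha v = max(X, 0)] gives [X v = alpha v ^ 2], both when [X] is
    nonnegative and when [v] vanishes. This pointwise identity is
    [energy_density_rate].

    The analysis behind this computation has four ingredients. Open sets are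
    measurable for the outer measure built from boxes, and bounded sets have
    finite measure ([measurable_open], [Leb_bounded]). The first-order space
    derivatives commute with the one-sided time derivative ([pder_tder]), which
    identifies [grad u'] in Green's formula with the rate of [grad u]. The
    energy densities are polynomials in [Theta] and in functions that are
    bounded and Lipschitz in time, hence they are Lipschitz in time with a
    constant of order [1 + Theta ^ 2], integrable because [Theta] is square
    integrable ([weighted_field], [is_tder_weighted_field]). Finally, the
    boundary conditions hold outside null sets that may depend on the time;
    rational times are enough to fix one null set for the time derivative
    ([ae_tder_eq0]). *)

(** * Lebesgue measure of open sets *)

Section lebesgue_borel.
Context (R : realType) (d : nat).
Implicit Types (A : set 'rV[R]_d) (i : 'I_d) (c : R).

(** Cutting a box by a hyperplane orthogonal to an axis gives two boxes whose
    volumes add up; clamping the cut to the box covers the case where the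
    hyperplane misses it. *)
Lemma box_gauge_split A i c :
  (box_gauge (A `&` [set x | (x 0 i <= c)%R]) +
   box_gauge (A `&` ~` [set x | (x 0 i <= c)%R]) <= box_gauge A)%E.
Proof.
apply: le_ereal_inf_tmp => _ [a [b [ab Aab ->]]].
pose c' : R := Num.max (a 0 i) (Num.min c (b 0 i)).
have ac' : a 0 i <= c' by rewrite le_max lexx.
have c'b : c' <= b 0 i by rewrite ge_max ab ge_min lexx orbT.
pose b' : 'rV[R]_d := \row_j (if j == i then c' else b 0 j).
pose a' : 'rV[R]_d := \row_j (if j == i then c' else a 0 j).
rewrite (bigD1 i) //=.
rewrite -[b 0 i - a 0 i](subrKA c') (addrC (b 0 i - c')) mulrDl EFinD; apply: leeD.
- apply: ereal_inf_lbound; exists a, b'; split.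
  + by move=> j; rewrite mxE; case: eqP => [->|].
  + move=> x [/Aab xab /= xc] j; rewrite mxE.
    have /andP[-> xb] := xab j; case: eqP => [ji|//]; subst j.
    by rewrite /c' le_max le_min xc xb orbT.
  + congr _%:E; rewrite [RHS](bigD1 i) //= mxE eqxx; congr (_ * _).
    by apply: eq_bigr => j /negbTE ji; rewrite mxE ji.
- apply: ereal_inf_lbound; exists a', b; split.
  + by move=> j; rewrite mxE; case: eqP => [->|].
  + move=> x [/Aab xab /= /negP xc] j; rewrite -ltNge in xc; rewrite mxE.
    have /andP[xa ->] := xab j; case: eqP => [ji|]; subst; last by rewrite xa.
    by rewrite /c' gt_max xa gt_min xc.
  + congr _%:E; rewrite [RHS](bigD1 i) //= mxE eqxx; congr (_ * _).
    by apply: eq_bigr => j /negbTE ji; rewrite mxE ji.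
Qed.

Lemma gauge0_le (c : set 'rV[R]_d -> \bar R) A :
  (forall B, 0 <= c B)%E -> (gauge0 c A <= c A)%E.
Proof. by move=> c0; rewrite /gauge0; case: pselect => /= _; [exact: c0|exact: lexx]. Qed.

(** Caratheodory's condition for a half-space: cut each member of a cover. *)
Lemma lebesgue_outer_split A i c :
  (lebesgue_outer (A `&` [set x | (x 0 i <= c)%R]) +
   lebesgue_outer (A `&` ~` [set x | (x 0 i <= c)%R]) <= lebesgue_outer A)%E.
Proof.
set H := [set x | _]; pose g := gauge0 (@box_gauge R d).
have g0 B : (0 <= g B)%E by exact: gauge0_ge0 (@box_gauge_ge0 R d) B.
apply: le_ereal_inf_tmp => _ [F [mF AF] <-].
apply: (@le_trans _ _ (\sum_(0 <= k <oo) (g (F k `&` H) + g (F k `&` ~` H)))%E).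
  rewrite nneseriesD//; apply: leeD; apply: ereal_inf_lbound.
  - exists (fun k => F k `&` H) => //; split=> // x [/AF [k _ Fk] Hx].
    by exists k.
  - exists (fun k => F k `&` ~` H) => //; split=> // x [/AF [k _ Fk] Hx].
    by exists k.
apply: lee_nneseries => [k _ _|k _]; first exact: adde_ge0.
rewrite [leRHS]/gauge0; case: pselect => /= [->|_].
  by rewrite !set0I /g gauge00 ?adde0//; exact: box_gauge_ge0.
apply: le_trans (box_gauge_split (F k) i c).
by apply: leeD; apply: gauge0_le => B; exact: box_gauge_ge0.
Qed.

Let om : {outer_measure set 'rV[R]_d -> \bar R} := @lebesgue_outer R d.

Lemma measurable_halfspace i c :
  measurable ([set x | (x 0 i <= c)%R] : set (caratheodory_type om)).
Proof.
exact: (@le_caratheodory_measurable _ _ om _ (fun X => lebesgue_outer_split X i c)).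
Qed.

(** Every point of an open set lies in a half-open cube with rational data that
    is contained in the set, and there are countably many such cubes. *)
Lemma measurable_open A : open A -> measurable (A : set (caratheodory_type om)).
Proof.
move=> oA.
pose Q (q : 'rV[rat]_d * rat) : set (caratheodory_type om) :=
  \bigcap_(i in [set: 'I_d]) ([set x | x 0 i <= ratr (q.1 0 i) + ratr q.2] `&`
              ~` [set x | x 0 i <= ratr (q.1 0 i) - ratr q.2]).
have mQ q : measurable (Q q).
  apply: fin_bigcap_measurable => // i _; apply: measurableI.
    exact: measurable_halfspace.
  by apply: measurableC; exact: measurable_halfspace.
have -> : A = \bigcup_(q : 'rV[rat]_d * rat)
    (if pselect (Q q `<=` A) then Q q else set0).
  apply/seteqP; split => [x Ax|x [q _]]; last first.
    by case: pselect => // QA /QA.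
  have /nbhs_ballP[e /= e0 xeA] : nbhs x A by exact: open_nbhs_nbhs.
  (* The radius is below [e / 2], as the centre of the cube is not [x]. *)
  have [r re] := rat_in_itvoo (divr_gt0 e0 (ltr0n _ 2)).
  rewrite in_itv/= in re; have /andP[r0 re2] := re.
  have /(_ _)/cid-/all_sig[q qP] : forall i, exists q : rat,
      x 0 i - ratr r < ratr q < x 0 i + ratr r.
    move=> i; have xx : x 0 i - ratr r < x 0 i + ratr r by lra.
    by have [q] := rat_in_itvoo xx; rewrite in_itv/=; exists q.
  exists (\row_i q i, r) => //.
  case: pselect => [_ i _ /=|].
    by rewrite mxE; have := qP i; split; [|apply/negP; rewrite -ltNge]; lra.
  case=> y Qy; apply: xeA; split => // i j.
  have [] := Qy j I; rewrite /= mxE ord1 => y1 /negP; rewrite -ltNge => y2.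
  by have := qP j; rewrite /ball/= ltr_norml; lra.
apply: countable_bigcupT_measurable => [|q]; first exact: countableP.
by case: pselect => /= _; [exact: mQ|exact: measurable0].
Qed.

(** The outer measure is at most the gauge of the set itself: cover it by
    itself and by empty sets, which count for 0. *)
Lemma Leb_bounded A : bounded_set A -> (Leb A < +oo)%E.
Proof.
move=> [M [Mr MA]]; pose K : R := `|M| + 1.
have K0 : 0 <= K by rewrite addr_ge0.
have AK : A `<=` box (const_mx (- K - 1)) (const_mx K).
  have MK : M < K by rewrite /K; have := ler_norm M; lra.
  move=> x Ax i; have xK : `|x| <= K := MA K MK x Ax.
  rewrite !mxE; have : `|x 0 i| <= K.
    apply: le_trans xK; rewrite /Num.Def.normr /= mx_normrE.
    exact: (le_bigmax _ (fun ij : 'I_1 * 'I_d => `|x ij.1 ij.2|) (0, i)).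
  by rewrite ler_norml; lra.
apply: (@le_lt_trans _ _ (box_gauge A)).
  apply: (@le_trans _ _ (\sum_(0 <= k <oo)
      gauge0 (@box_gauge R d) (if k == 0%N then A else set0))%E).
    apply: ereal_inf_lbound; exists (fun k => if k == 0%N then A else set0) => //.
    by split=> // x Ax; exists 0%N.
  have g0 B : (0 <= gauge0 (@box_gauge R d) B)%E.
    exact: gauge0_ge0 (@box_gauge_ge0 R d) B.
  rewrite nneseries_recl//= eseries0 ?adde0.
    by apply: gauge0_le => B; exact: box_gauge_ge0.
  by case=> //= k _ _; rewrite gauge00//; exact: box_gauge_ge0.
apply: (@le_lt_trans _ _
  (\prod_i ((const_mx K : 'rV[R]_d) 0 i - (const_mx (- K - 1) : 'rV[R]_d) 0 i))%:E).
  apply: ereal_inf_lbound; exists (const_mx (- K - 1)), (const_mx K).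
  by split => // i; rewrite !mxE; lra.
exact: ltry.
Qed.

Lemma continuous_within_measurable A (f : 'rV[R]_d -> R) : open A ->
  {within A, continuous f} ->
  measurable_fun (A : set (caratheodory_type om)) f.
Proof.
move=> oA /continuousP cf; apply: (measurability _ (RGenOpens.measurableE R)).
move=> _ [_ [a [b ->] <-]].
have /open_subspaceP[V oV VA] := cf _ (@interval_open _ (BRight a) (BLeft b) isT isT).
by rewrite setIC -VA; apply: measurable_open; exact: openI.
Qed.

End lebesgue_borel.

(** R^d with the Caratheodory sigma-algebra on which [Leb] is a measure. *)
Local Notation LT R d := (caratheodory_type
  ((@lebesgue_outer R d) : {outer_measure set 'rV[R]_d -> \bar R})).

(** * One-sided time derivatives *)

Section time_derivative.
Context (R : realType) (T : R).
Implicit Types (f g : R -> R) (s t l m : R).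

Lemma within_itv_proper t : 0 < T -> t \in `[0, T] ->
  ProperFilter (within `[0, T] t^').
Proof.
move=> T0; rewrite in_itv/= => /andP[t0 tT].
apply: Build_ProperFilter_ex => P [e /= e0 tP].
suff [s [sT st te]] : exists s, [/\ s \in `[0, T], s != t & `|t - s| < e].
  by exists s; apply: tP => //=.
have [tT'|Tt] := ltP t T.
- exists (t + Num.min (e / 2) (T - t)).
  have m0 : 0 < Num.min (e / 2) (T - t).
    by rewrite lt_min divr_gt0//= subr_gt0.
  have m1 : Num.min (e / 2) (T - t) <= T - t by rewrite ge_min lexx orbT.
  have m2 : Num.min (e / 2) (T - t) <= e / 2 by rewrite ge_min lexx.
  split; first by rewrite in_itv/=; lra.
    by apply/eqP; lra.
  by rewrite ltr_norml; lra.
- exists (t - Num.min (e / 2) t).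
  have t0' : 0 < t by lra.
  have m0 : 0 < Num.min (e / 2) t by rewrite lt_min divr_gt0.
  have m1 : Num.min (e / 2) t <= t by rewrite ge_min lexx orbT.
  have m2 : Num.min (e / 2) t <= e / 2 by rewrite ge_min lexx.
  split; first by rewrite in_itv/=; lra.
    by apply/eqP; lra.
  by rewrite ltr_norml; lra.
Qed.

Lemma near_within_itv t : \forall s \near within `[0, T] t^', s \in `[0, T].
Proof. exact: (@withinT _ t^' `[0, T]%classic). Qed.

Lemma tder_eq f t l : 0 < T -> t \in `[0, T] ->
  is_tder T f t l -> tder T f t = l.
Proof. by move=> T0 tT; have ? := within_itv_proper T0 tT; exact: cvg_lim. Qed.

Lemma cvg_within_itv t : s @[s --> within `[0, T] t^'] --> t.
Proof.
by move=> A [e /= e0 eA]; exists e => //= s ts _ _; exact: eA.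
Qed.

Lemma eq_is_tder f g t l : t \in `[0, T] ->
  {in `[0, T], f =1 g} -> is_tder T f t l -> is_tder T g t l.
Proof.
move=> tT fg; apply: cvg_trans; apply: near_eq_cvg.
by have := @near_within_itv t; apply: filterS => s sT; rewrite /time_quot !fg.
Qed.

Lemma is_tder_cvg f t l : is_tder T f t l -> f s @[s --> within `[0, T] t^'] --> f t.
Proof.
move=> fl.
(* The identity also holds at [s = t], where the quotient is multiplied by 0. *)
have fE : f = (fun s => f t + (s - t) * time_quot f t s) :> (R -> R).
  apply/funext => s; rewrite /time_quot.
  have [->|st] := eqVneq s t; first by rewrite subrr mul0r addr0.
  by rewrite mulrA divff ?subr_eq0// mul1r addrC subrK.
rewrite [X in X s @[s --> _]]fE -[X in _ --> X]addr0.
apply: cvgD; first exact: cvg_cst.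
rewrite -[X in _ --> X](mul0r l); apply: cvgM => //.
rewrite -[X in _ --> X](subrr t).
by apply: cvgB; [exact: cvg_within_itv|exact: cvg_cst].
Qed.

Lemma is_tder_cst t c : is_tder T (cst c) t 0.
Proof.
rewrite /is_tder (_ : time_quot _ _ = cst 0); first exact: cvg_cst.
by apply/funext => s; rewrite /time_quot subrr mulr0.
Qed.

Lemma is_tderD f g t l m :
  is_tder T f t l -> is_tder T g t m -> is_tder T (fun s => f s + g s) t (l + m).
Proof.
move=> fl gm; rewrite /is_tder.
rewrite (_ : time_quot _ _ = fun s => time_quot f t s + time_quot g t s).
  exact: cvgD.
by apply/funext => s; rewrite /time_quot -mulrDr; congr (_ * _); ring.
Qed.

Lemma is_tderM f g t l m :
  is_tder T f t l -> is_tder T g t m ->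
  is_tder T (fun s => f s * g s) t (l * g t + f t * m).
Proof.
move=> fl gm; rewrite /is_tder.
rewrite (_ : time_quot _ _ = fun s => time_quot f t s * g s + f t * time_quot g t s).
  apply: cvgD; apply: cvgM => //; first exact: is_tder_cvg gm.
  exact: cvg_cst.
by apply/funext => s; rewrite /time_quot; ring.
Qed.

Lemma is_tderZ c f t l :
  is_tder T f t l -> is_tder T (fun s => c * f s) t (c * l).
Proof.
by move=> /(is_tderM (is_tder_cst t c)); rewrite mul0r add0r.
Qed.

(** Away from the end points, a punctured neighbourhood of
    [t] already consists of admissible times. *)
Lemma is_tder_is_derive f t l : t \in `]0, T[ -> is_tder T f t l ->
  is_derive t 1 f l.
Proof.
rewrite in_itv/= => /andP[t0 tT] fl.
have h : h^-1 *: ((f \o shift t) (h *: 1) - f t) @[h --> 0^'] --> l.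
  rewrite (_ : (fun h => _) = time_quot f t \o (fun h => h + t)); last first.
    by apply/funext => h /=; rewrite /time_quot addrK /GRing.scale/= mulr1.
  apply: cvg_comp fl => A [e /= e0 eA].
  exists (Num.min e (Num.min t (T - t))) => /=.
    by rewrite !lt_min e0 t0 subr_gt0.
  move=> h /=; rewrite sub0r normrN !lt_min => /and3P[he ht hT] h0.
  apply: eA => /=.
  - by rewrite opprD addrCA subrr addr0 normrN.
  - by rewrite -subr_eq0 addrK.
  - by rewrite in_itv/=; move: ht hT; rewrite !ltr_norml; lra.
have df : derivable f t 1 by apply/cvg_ex; exists l.
by apply: DeriveDef => //; exact: cvg_lim h.
Qed.

Lemma tder_continuous f : (forall t, t \in `[0, T] -> tderivable T f t) ->
  {within `[0, T], continuous f}.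
Proof.
move=> df; apply/subspace_continuousP => t tT A ftA.
have [e /= e0 eA] := is_tder_cvg (df t tT) ftA.
exists e => // s /= ts sT.
have [->|st] := eqVneq s t; first exact: nbhs_singleton.
exact: eA.
Qed.

(** The intermediate point is located relative to [t] so that continuity of the
    derivative at [t] can be used when [s] tends to [t]. *)
Lemma tder_MVT f s t : (forall r, r \in `[0, T] -> tderivable T f r) ->
  s \in `[0, T] -> t \in `[0, T] ->
  exists2 c, c \in `[0, T] /\ `|c - t| <= `|s - t| &
    f s - f t = tder T f c * (s - t).
Proof.
move=> df.
have lt_case a b : a \in `[0, T] -> b \in `[0, T] -> a <= b ->
    exists2 c, c \in `[a, b] & f b - f a = tder T f c * (b - a).
  rewrite !in_itv/= => /andP[a0 aT] /andP[b0 bT] ab.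
  apply: MVT_segment => // [x|].
    rewrite in_itv/= => /andP[ax xb]; apply: is_tder_is_derive.
      by rewrite in_itv/=; lra.
    by apply: df; rewrite in_itv/=; lra.
  apply: continuous_subspaceW (tder_continuous df) => x /=.
  by rewrite !in_itv/=; lra.
move=> sT tT; have [st|ts] := leP s t.
- have [c cst e] := lt_case s t sT tT st.
  exists c; last by rewrite -opprB e; ring.
  move: sT tT cst; rewrite !in_itv/= => sT tT cst.
  by split; [|rewrite !ler0_norm]; lra.
- have [c cst e] := lt_case t s tT sT (ltW ts).
  exists c => //.
  move: sT tT cst; rewrite !in_itv/= => sT tT cst.
  by split; [|rewrite !ger0_norm]; lra.
Qed.

(** Dominated convergence is a statement about sequences; this transfers it to
    the filter that defines the time derivative. *)
Lemma cvg_within_itv_seq (g : R -> R) t l :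
  (forall v : R^nat, (forall k, v k \in `[0, T]) -> (forall k, v k != t) ->
     v @ \oo --> t -> g (v k) @[k --> \oo] --> l) ->
  g s @[s --> within `[0, T] t^'] --> l.
Proof.
move=> gl; apply: contrapT => /cvgrPdist_lt/existsNP[e /not_implyP[e0 nge]].
have /(_ _)/cid-/all_sig[v vP] k : exists s, [/\ s \in `[0, T], s != t,
    `|t - s| < k.+1%:R^-1 & ~ (`|l - g s| < e)].
  apply: contrapT => /forallNP H; apply: nge.
  exists k.+1%:R^-1 => //= s ts st sT.
  by apply: contrapT => ns; apply: (H s).
have vt : v @ \oo --> t.
  apply/cvgrPdist_lt => r r0; near=> k.
  have [_ _ + _] := vP k; move/lt_trans; apply.
  near: k; exact: near_infty_natSinv_lt (PosNum r0).
have /cvgrPdist_lt/(_ e e0) := gl v (fun k => let: And4 a _ _ _ := vP k in a)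
  (fun k => let: And4 _ a _ _ := vP k in a) vt.
by case=> k _ /(_ k (leqnn k)); have [_ _ _] := vP k.
Unshelve. all: by end_near. Qed.

End time_derivative.

(** * Symmetry of mixed derivatives *)

Section mixed_derivatives.
Context (R : realType) (d : nat).
Implicit Types (Om : set 'rV[R]_d) (T : R).

Lemma is_derive_line (g : 'rV[R]_d -> R) (x e : 'rV[R]_d) (r : R) :
  derivable g (r *: e + x) e ->
  is_derive r 1 (fun a => g (a *: e + x)) ('D_e g (r *: e + x)).
Proof.
move=> dg.
have quotE : (fun h : R => h^-1 *: (((fun a : R => g (a *: e + x)) \o shift r) (h *: 1)
    - g (r *: e + x))) =
    (fun h : R => h^-1 *: ((g \o shift (r *: e + x)) (h *: e) - g (r *: e + x))).
  apply/funext => h /=; congr (_ *: (g _ - _)).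
  by rewrite (_ : h *: (1 : R) = h) ?scalerDl ?addrA//; exact: mulr1.
by apply: DeriveDef; rewrite /derivable /derive quotE.
Qed.

Lemma MVT_centered (g dg : R -> R) (r : R) :
  (forall a, `|a| <= `|r| -> is_derive (a : R) 1 g (dg a)) ->
  exists2 c, `|c| <= `|r| & g r - g 0 = dg c * r.
Proof.
move=> gdg; have [r0|r0] := leP 0 r.
- have rE : `|r| = r by rewrite ger0_norm.
  have [a||c] := @MVT_segment R g dg 0 r r0.
  + by rewrite in_itv/= => a0r; apply: gdg; rewrite rE ler_norml; lra.
  + apply: derivable_within_continuous => a; rewrite in_itv/= => a0r.
    by apply: (@ex_derive _ _ _ _ _ _ _ (gdg a _)); rewrite rE ler_norml; lra.
  + rewrite in_itv/= subr0 => c0r e; exists c => //.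
    by rewrite rE ler_norml; lra.
- have rE : `|r| = - r by rewrite ltr0_norm.
  have [a||c] := @MVT_segment R g dg r 0 (ltW r0).
  + by rewrite in_itv/= => a0r; apply: gdg; rewrite rE ler_norml; lra.
  + apply: derivable_within_continuous => a; rewrite in_itv/= => a0r.
    by apply: (@ex_derive _ _ _ _ _ _ _ (gdg a _)); rewrite rE ler_norml; lra.
  + rewrite in_itv/= sub0r => c0r e; exists c; last by rewrite -opprB e; ring.
    by rewrite rE ler_norml; lra.
Qed.

Lemma cylinder_cvg Om T (h : 'rV[R]_d * R -> R) x t :
  {within cylinder Om T, continuous h} -> closure Om x -> t \in `[0, T] ->
  forall e, 0 < e -> exists2 r, 0 < r & forall y s,
    closure Om y -> s \in `[0, T] -> ball x r y -> `|t - s| < r ->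
    `|h (x, t) - h (y, s)| < e.
Proof.
move=> /subspace_continuousP hc Omx tT e e0.
have /cvgrPdist_lt/(_ e e0)/nbhs_ballP[r /= r0 rP] := hc (x, t) (conj Omx tT).
by exists r => // y s Omy sT xy ts; apply: (rP (y, s)).
Qed.

Lemma ball_line (x : 'rV[R]_d) j (a r : R) :
  `|a| < r -> ball x r (a *: basis_vec R j + x).
Proof.
move=> ar; split; first exact: le_lt_trans (normr_ge0 a) ar.
move=> i k; rewrite /ball/= !mxE opprD addrCA subrr addr0 normrN.
case: (_ && _); rewrite ?mulr1 ?mulr0//.
by rewrite normr0; exact: le_lt_trans (normr_ge0 a) ar.
Qed.

(** Symmetry of mixed derivatives: the mean value theorem in space and then in
    time writes the second difference quotient of [f] as a value of the
    continuous mixed derivative at a nearby point; time tends to [t] first. *)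
Lemma pder_tder Om T (f : 'rV[R]_d -> R -> R) j x t :
  0 < T -> open Om -> C1_field Om T f -> Om x -> t \in `[0, T] ->
  pder j (fun y => tder T (f y) t) x = tder T (fun s => pder j (f^~ s) x) t.
Proof.
move=> T0 oOm [_ df _ /(_ j)[dxf _ dtxf [h hc hE]]] Omx tT.
have FF := within_itv_proper T0 tT.
have clOm y : Om y -> closure Om y by exact: subset_closure.
rewrite -hE//; apply: cvg_lim => //; apply/cvgrPdist_le => e e0.
have [r1 r10 r1P] := cylinder_cvg hc (clOm _ Omx) tT e0.
have /nbhs_ballP[r2 /= r20 r2P] : nbhs x Om by exact: open_nbhs_nbhs.
exists (Num.min r1 r2) => /=; first by rewrite lt_min r10.
move=> a /=; rewrite sub0r normrN lt_min => /andP[ar1 ar2] a0.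
have Oma b : `|b| <= `|a| -> Om (b *: basis_vec R j + x).
  by move=> ba; apply: r2P; apply: ball_line; exact: le_lt_trans ba ar2.
(* Let [s] tend to [t] in the second difference quotient at fixed [a]. *)
have quot_cvg : a^-1 * (time_quot (f (a *: basis_vec R j + x)) t s - time_quot (f x) t s)
    @[s --> within `[0, T] t^'] -->
  a^-1 * (tder T (f (a *: basis_vec R j + x)) t - tder T (f x) t).
  apply: cvgM; first exact: cvg_cst.
  by apply: cvgB; apply: df => //; apply: clOm => //; exact: Oma.
have dist_cvg : `|h (x, t) - a^-1 *
      (time_quot (f (a *: basis_vec R j + x)) t s - time_quot (f x) t s)|
    @[s --> within `[0, T] t^'] -->
  `|h (x, t) - a^-1 * (tder T (f (a *: basis_vec R j + x)) t - tder T (f x) t)|.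
  by apply: cvg_norm; apply: cvgB => //; exact: cvg_cst.
rewrite /= -[_ *: _]/(a^-1 * _).
apply: (cvgr_to_le dist_cvg).
exists r1 => //= s ts st sT.
pose g b := f (b *: basis_vec R j + x) s - f (b *: basis_vec R j + x) t.
pose p b s := pder j (f^~ s) (b *: basis_vec R j + x).
have [|c ca gE] := @MVT_centered g (fun b => p b s - p b t) a.
  move=> b ba; apply: is_deriveB; apply: is_derive_line;
  by apply: dxf => //; exact: Oma.
have [c' [c'T c't] pE] := tder_MVT (fun s sT => dtxf _ s (Oma c ca) sT) sT tT.
rewrite /time_quot.
have -> : a^-1 * ((s - t)^-1 * (f (a *: basis_vec R j + x) s - f (a *: basis_vec R j + x) t) -
   (s - t)^-1 * (f x s - f x t)) = h (c *: basis_vec R j + x, c').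
  rewrite hE//; last exact: Oma.
  rewrite -mulrBr; move: gE; rewrite {1 2}/g scale0r add0r => ->.
  rewrite /p pE; field.
  by rewrite a0 subr_eq0 st.
apply/ltW/r1P => //; first by apply: clOm; exact: Oma.
  by apply: ball_line; exact: le_lt_trans ca ar1.
by rewrite distrC (le_lt_trans c't)// distrC.
Qed.

End mixed_derivatives.

(** * Differentiation under the integral sign *)

Section integral_of_fields.
Context (R : realType) (disp : measure_display) (X : measurableType disp).
Variables (mu : {measure set X -> \bar R}) (D : set X) (T : R).
Hypothesis mD : measurable D.
Implicit Types (f g : X -> R -> R) (w : X -> R).

(** Leibniz rule at a single time, end points included; sequences of times
    suffice because the neighbourhoods of a time have a countable basis. *)
Lemma is_tder_Rintegral f (g K : X -> R) t : t \in `[0, T] ->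
  (forall s, s \in `[0, T] -> mu.-integrable D (EFin \o f^~ s)) ->
  (forall x, D x -> is_tder T (f x) t (g x)) ->
  mu.-integrable D (EFin \o K) ->
  (forall x s, D x -> s \in `[0, T] -> `|f x s - f x t| <= K x * `|s - t|) ->
  is_tder T (fun s => \int[mu]_(x in D) f x s) t (\int[mu]_(x in D) g x).
Proof.
move=> tT intf dfg intK lipf; apply: cvg_within_itv_seq => v vT vt v_t.
have v_within : v @ \oo --> within `[0, T] t^'.
  move=> A [e /= e0 eA].
  have /cvgrPdist_lt/(_ e e0) := v_t; apply: filterS => k tk.
  exact: eA.
pose q k x := time_quot (f x) t (v k).
have intq k : mu.-integrable D (EFin \o q k).
  rewrite (_ : _ \o _ = fun x => ((v k - t)^-1)%:E * (f x (v k) - f x t)%:E)%E //.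
  apply: integrableZl => //.
  rewrite (_ : (fun x => _) = (EFin \o f^~ (v k)) \- (EFin \o f^~ t))%E //.
  by apply: integrableB => //; apply: intf.
have qK k x : D x -> `|q k x| <= K x.
  move=> Dx; rewrite /q /time_quot normrM normfV ler_pdivrMl ?normr_gt0 ?subr_eq0//.
  by rewrite mulrC; exact: lipf.
have qg x : D x -> q ^~ x @ \oo --> g x.
  by move=> Dx; have := dfg x Dx; exact: cvg_comp.
have mq k : measurable_fun D (q k).
  by apply/measurable_EFinP; exact: measurable_int (intq k).
have [|||intg _ cvgq] := @dominated_convergence _ _ _ mu D mD (fun k => EFin \o q k)
    (EFin \o g) (EFin \o K) (fun k => measurable_int _ (intq k)) _ _ intK.
- by apply/measurable_EFinP; exact: measurable_fun_cvg mq qg.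
- by apply: aeW => x Dx; apply: cvg_EFin; [exact: nearW|exact: qg].
- by apply: aeW => x k Dx /=; rewrite lee_fin; exact: qK.
rewrite (_ : (fun k => _) = fine \o (fun k => \int[mu]_(x in D) (EFin \o q k) x)%E).
  by apply: fine_cvg; rewrite fineK; [exact: cvgq|exact: integrable_fin_num].
apply/funext => k; rewrite /time_quot -RintegralB//; [|exact: intf..].
rewrite -RintegralZl//.
rewrite (_ : _ \o _ = (EFin \o f^~ (v k)) \- (EFin \o f^~ t))%E //.
by apply: integrableB => //; apply: intf.
Qed.

(** Space-time functions that are measurable in space, differentiable in time,
    and bounded and Lipschitz in time with a constant controlled by the weight
    [w].  Products multiply the weights, so that polynomials in such functions
    are of the same kind, and an integrable weight allows differentiation
    under the integral sign. *)
Definition weighted_field w f (df : X -> R -> R) :=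
  [/\ forall t, t \in `[0, T] -> measurable_fun D (f^~ t),
      forall x t, D x -> t \in `[0, T] -> is_tder T (f x) t (df x t) &
      exists2 M : R, 0 <= M & forall x s t, D x -> s \in `[0, T] -> t \in `[0, T] ->
        `|f x s| <= M * w x /\ `|f x s - f x t| <= M * w x * `|s - t|].

Lemma weighted_field_stationary w (g : X -> R) : measurable_fun D g ->
  (forall x, D x -> `|g x| <= w x) ->
  weighted_field w (fun x _ => g x) (fun _ _ => 0).
Proof.
move=> mg gw; split=> //.
  by move=> x t _ _; exact: is_tder_cst.
exists 1 => // x s t Dx _ _; rewrite mul1r subrr normr0; split; first exact: gw.
by rewrite mulr_ge0// (le_trans _ (gw x Dx)).
Qed.

Lemma weighted_fieldW w w' f df : (forall x, D x -> w x <= w' x) ->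
  weighted_field w f df -> weighted_field w' f df.
Proof.
move=> ww' [mf dff [M M0 fM]]; split=> //; exists M => // x s t Dx sT tT.
have [f1 f2] := fM x s t Dx sT tT.
have ww := ler_wpM2l M0 (ww' x Dx).
by split; [exact: le_trans f1 ww|apply: le_trans f2 _; rewrite ler_wpM2r].
Qed.

Lemma weighted_fieldD w f df g dg :
  weighted_field w f df -> weighted_field w g dg ->
  weighted_field w (fun x t => f x t + g x t) (fun x t => df x t + dg x t).
Proof.
move=> [mf dff [M M0 fM]] [mg dfg [N N0 gN]]; split.
- by move=> t tT; apply: measurable_funD; [exact: mf|exact: mg].
- by move=> x t Dx tT; apply: is_tderD; [exact: dff|exact: dfg].
exists (M + N); first exact: addr_ge0.
move=> x s t Dx sT tT; have [f1 f2] := fM x s t Dx sT tT.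
have [g1 g2] := gN x s t Dx sT tT; split.
  by rewrite mulrDl (le_trans (ler_normD _ _))// lerD.
rewrite !mulrDl (_ : _ - _ = (f x s - f x t) + (g x s - g x t)); last by ring.
by rewrite (le_trans (ler_normD _ _))// lerD.
Qed.

Lemma weighted_fieldM w v f df g dg :
  weighted_field w f df -> weighted_field v g dg ->
  weighted_field (fun x => w x * v x) (fun x t => f x t * g x t)
    (fun x t => df x t * g x t + f x t * dg x t).
Proof.
move=> [mf dff [M M0 fM]] [mg dfg [N N0 gN]]; split.
- by move=> t tT; apply: measurable_funM; [exact: mf|exact: mg].
- by move=> x t Dx tT; apply: is_tderM; [exact: dff|exact: dfg].
exists (2 * (M * N)); first by rewrite mulr_ge0// mulr_ge0.
move=> x s t Dx sT tT; have [f1 f2] := fM x s t Dx sT tT.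
have [g1 g2] := gN x s t Dx sT tT; have [f3 _] := fM x t s Dx tT sT.
have Mw0 : 0 <= M * w x := le_trans (normr_ge0 _) f1.
have Nv0 : 0 <= N * v x := le_trans (normr_ge0 _) g1.
split.
  rewrite normrM (le_trans (ler_pM _ _ f1 g1))//.
  by have := mulr_ge0 Mw0 Nv0; lra.
rewrite (_ : _ - _ = (f x s - f x t) * g x s + f x t * (g x s - g x t)); last by ring.
rewrite (le_trans (ler_normD _ _))// !normrM.
have h1 := ler_pM (normr_ge0 _) (normr_ge0 _) f2 g1.
have h2 := ler_pM (normr_ge0 _) (normr_ge0 _) f3 g2.
rewrite (le_trans (lerD h1 h2))//.
by rewrite le_eqVlt; apply/orP; left; apply/eqP; ring.
Qed.

Lemma weighted_fieldZ w c f df : weighted_field w f df ->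
  weighted_field w (fun x t => c * f x t) (fun x t => c * df x t).
Proof.
move=> [mf dff [M M0 fM]]; split.
- by move=> t tT; apply: measurable_funM => //; exact: mf.
- by move=> x t Dx tT; apply: is_tderZ; exact: dff.
exists (`|c| * M); first by rewrite mulr_ge0.
move=> x s t Dx sT tT; have [f1 f2] := fM x s t Dx sT tT.
by rewrite -mulrBr !normrM -!mulrA; split; rewrite ler_wpM2l// mulrA.
Qed.

Lemma weighted_field_sum w (I : Type) (r : seq I) (f df : I -> X -> R -> R) :
  (forall x, D x -> 0 <= w x) ->
  (forall i, weighted_field w (f i) (df i)) ->
  weighted_field w (fun x t => \sum_(i <- r) f i x t)
                   (fun x t => \sum_(i <- r) df i x t).
Proof.
move=> w0 fdf; elim: r => [|i r ih].
  under eq_fun do under eq_fun do rewrite big_nil.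
  under [X in weighted_field _ _ X]eq_fun do under eq_fun do rewrite big_nil.
  by apply: weighted_field_stationary => // x Dx; rewrite normr0 w0.
under eq_fun do under eq_fun do rewrite big_cons.
under [X in weighted_field _ _ X]eq_fun do under eq_fun do rewrite big_cons.
exact: weighted_fieldD.
Qed.

Lemma weighted_field_integrable w f df t : mu.-integrable D (EFin \o w) ->
  weighted_field w f df -> t \in `[0, T] -> mu.-integrable D (EFin \o f^~ t).
Proof.
move=> iw [mf _ [M M0 fM]] tT.
apply: (@le_integrable _ _ _ _ _ mD _ (fun x => M%:E * (EFin \o w) x)%E).
- by apply/measurable_EFinP; exact: mf.
- move=> x Dx /=; rewrite lee_fin; have [f1 _] := fM x t t Dx tT tT.
  by rewrite (le_trans f1)// ler_norm.
- exact: integrableZl.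
Qed.

Lemma is_tder_weighted_field w f df t : mu.-integrable D (EFin \o w) ->
  weighted_field w f df -> t \in `[0, T] ->
  is_tder T (fun s => \int[mu]_(x in D) f x s) t (\int[mu]_(x in D) df x t).
Proof.
move=> iw fdf tT; have [mf dff [M M0 fM]] := fdf.
apply: (@is_tder_Rintegral _ _ (fun x => M * w x)) => //.
- by move=> s sT; exact: weighted_field_integrable fdf sT.
- by move=> x Dx; exact: dff.
- by rewrite (_ : _ \o _ = fun x => M%:E * (EFin \o w) x)%E//; exact: integrableZl.
- by move=> x s Dx sT; have [] := fM x s t Dx sT tT.
Qed.

Lemma Rintegral_sum_eq0 (I : Type) (r : seq I) (g : I -> X -> R) :
  (forall i, mu.-integrable D (EFin \o g i)) ->
  (forall i, \int[mu]_(x in D) g i x = 0) ->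
  mu.-integrable D (EFin \o (fun x => \sum_(i <- r) g i x)) /\
  \int[mu]_(x in D) (\sum_(i <- r) g i x) = 0.
Proof.
move=> ig g0; elim: r => [|i r [ir r0]].
  under [X in EFin \o X]eq_fun do rewrite big_nil.
  under eq_Rintegral do rewrite big_nil.
  by split; [exact: integrable0|rewrite /Rintegral integral0].
under [X in EFin \o X]eq_fun do rewrite big_cons.
under eq_Rintegral do rewrite big_cons.
split; first exact: (integrableD mD (ig i) ir).
by rewrite RintegralD// g0 r0 addr0.
Qed.

End integral_of_fields.

(** * Smooth fields on a bounded cylinder *)

Section smooth_fields.
Context (R : realType) (d : nat) (Om : set 'rV[R]_d) (T : R).

Lemma bounded_closure (A : set 'rV[R]_d) : bounded_set A -> bounded_set (closure A).
Proof.
move=> [M [Mr AM]]; exists (M + 1); split; first by rewrite realD.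
move=> K MK x clAx /=; have [y [Ay]] := clAx _ (nbhsx_ballx x 1 ltr01).
rewrite -ball_normE /= => xy.
have yK : `|y| <= K - 1 by apply: (AM (K - 1)) => //; lra.
rewrite -(subrK y x) (le_trans (ler_normD _ _))//.
by move: xy; lra.
Qed.

Lemma cylinder_bounded (h : 'rV[R]_d * R -> R) : bounded_set Om ->
  {within cylinder Om T, continuous h} ->
  exists2 M : R, 0 <= M & forall x t, closure Om x -> t \in `[0, T] -> `|h (x, t)| <= M.
Proof.
move=> bOm hc; have cC : compact (cylinder Om T).
  apply: compact_setX; last exact: segment_compact.
  by apply: bounded_closed_compact; [exact: bounded_closure|exact: closed_closure].
have [M [Mr hM]] := compact_bounded (continuous_compact hc cC).
exists (`|M| + 1); first by rewrite addr_ge0.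
move=> x t Omx tT; apply: (hM (`|M| + 1)); last by exists (x, t).
by have := ler_norm M; lra.
Qed.

Lemma cylinder_slice_measurable (h : 'rV[R]_d * R -> R) (t : R) : open Om ->
  {within cylinder Om T, continuous h} -> t \in `[0, T] ->
  measurable_fun (Om : set (LT R d)) (fun x => h (x, t)).
Proof.
move=> oOm hc tT; apply: continuous_within_measurable => //.
apply/subspace_continuousP => x Omx; apply/cvgrPdist_lt => e e0.
have [r r0 rP] := cylinder_cvg hc (subset_closure Omx) tT e0.
apply/nbhs_ballP; exists r => //= y xy Omy; apply: rP => //.
  exact: subset_closure.
by rewrite subrr normr0.
Qed.

(** The mean value theorem in time turns the bound of the time derivative on
    the compact cylinder into a Lipschitz constant. *)
Lemma weighted_field_cylinder (f : 'rV[R]_d -> R -> R) :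
  open Om -> bounded_set Om ->
  cont_up_to_boundary Om T f ->
  (forall x t, Om x -> t \in `[0, T] -> tderivable T (f x) t) ->
  cont_up_to_boundary Om T (fun x => tder T (f x)) ->
  weighted_field (Om : set (LT R d)) T (cst 1) f (fun x => tder T (f x)).
Proof.
move=> oOm bOm [h hc hE] df [k kc kE]; split.
- move=> t tT; apply: (@eq_measurable_fun _ _ (LT R d : measurableType _) R
    (Om : set (LT R d)) (fun x => h (x, t))).
    by move=> x; rewrite inE => Omx; exact: hE.
  exact: cylinder_slice_measurable.
- by move=> x t Omx tT; exact: df.
have [M M0 hM] := cylinder_bounded bOm hc.
have [N N0 kN] := cylinder_bounded bOm kc.
exists (M + N); first exact: addr_ge0.
move=> x s t Omx sT tT; rewrite mulr1.
have clx := @subset_closure _ Om x Omx.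
split; first by rewrite -hE// (le_trans (hM _ _ clx sT))// lerDl.
have [c [cT _] ->] := tder_MVT (fun r rT => df x r Omx rT) sT tT.
rewrite normrM ler_wpM2r// -kE// (le_trans (kN _ _ clx cT))//.
by rewrite lerDr.
Qed.

Lemma continuous_cont_up_to_boundary (f : 'rV[R]_d -> R -> R) :
  {within cylinder Om T, continuous (fun p => f p.1 p.2)} ->
  cont_up_to_boundary Om T f.
Proof. by move=> fc; exists (fun p => f p.1 p.2). Qed.

Lemma C1_weighted_field f : open Om -> bounded_set Om -> C1_field Om T f ->
  weighted_field (Om : set (LT R d)) T (cst 1) f (fun x => tder T (f x)).
Proof.
move=> oOm bOm [fc df dfc _]; apply: weighted_field_cylinder => //.
- exact: continuous_cont_up_to_boundary.
- by move=> x t Omx; apply: df; exact: subset_closure.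
- exact: continuous_cont_up_to_boundary.
Qed.

Lemma C1_pder_weighted_field f j : open Om -> bounded_set Om -> C1_field Om T f ->
  weighted_field (Om : set (LT R d)) T (cst 1) (fun x t => pder j (f^~ t) x)
    (fun x => tder T (fun s => pder j (f^~ s) x)).
Proof.
move=> oOm bOm [_ _ _ /(_ j)[_ dxc dtx dtxc]].
exact: weighted_field_cylinder.
Qed.

Lemma C1_tder_integrable_sqr f t : open Om -> bounded_set Om -> C1_field Om T f ->
  t \in `[0, T] ->
  (Leb : {measure set (LT R d) -> \bar R}).-integrable Om (fun x => (`|tder T (f x) t| ^+ 2)%:E).
Proof.
move=> oOm bOm [_ _ dfc _] tT.
apply: measurable_bounded_integrable.
- exact: measurable_open.
- exact: Leb_bounded.
- have mdf := cylinder_slice_measurable oOm dfc tT.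
  exact: (measurable_funX 2 (measurableT_comp (@normr_measurable R setT) mdf)).
have [M M0 fM] := cylinder_bounded bOm dfc.
exists (M ^+ 2); split; first by rewrite realX// ger0_real.
move=> K MK x Omx /=; apply: le_trans (ltW MK).
rewrite ger0_norm ?exprn_ge0// lerXn2r ?nnegrE//.
by have := fM x t (subset_closure Omx) tT.
Qed.

End smooth_fields.

(** * Vanishing boundary terms *)

(** The constant [Surf] hides the measure from instance inference. *)
#[global] Instance ae_Surf_filter (R : realType) d :
  Filter (nbhs (almost_everywhere (@Surf R d))).
Proof. exact: (@ae_filter_ringOfSetsType _ _ _ (@Haus R d d.-1)). Qed.

Section boundary_terms.
Context (R : realType).

(** Completeness of the measure makes a function that vanishes almost everywhere
    measurable, whatever the set [D]. *)
Lemma ae_zero_Rintegral (disp : measure_display) (X : measurableType disp)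
    (mu : {measure set X -> \bar R}) (D : set X) (f : X -> R) :
  measure_is_complete mu -> {ae mu, forall x, D x -> f x = 0} ->
  \int[mu]_(x in D) f x = 0.
Proof.
move=> cmu f0; rewrite Rintegral_mkcond /Rintegral.
have fD0 : ae_eq mu setT (cst 0%E) (fun x => ((f \_ D) x)%:E).
  apply: filterS f0 => x fx _; rewrite patchE; case: ifPn => // /set_mem Dx.
  by rewrite fx.
rewrite -(ae_eq_integral _ _ measurableT (@measurable_cst _ _ _ _ setT 0%E)
  _ fD0) ?integral0//.
exact: (ae_measurable_fun cmu fD0).
Qed.

Lemma continuous_rat_eq (T : R) (f : R -> R) (c : R) : 0 < T ->
  {within `[0, T], continuous f} ->
  (forall q : rat, ratr q \in `[0, T] -> f (ratr q) = c) ->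
  {in `[0, T], f =1 cst c}.
Proof.
move=> T0 /subspace_continuousP fc fq s sT; apply/eqP; apply: contrapT => /negP fsc.
have e0 : 0 < `|f s - c| by rewrite normr_gt0 subr_eq0.
have /cvgrPdist_lt/(_ _ e0)[r /= r0 rP] := fc s sT.
have [q qP] : exists q : rat, Num.max 0 (s - r) < ratr q < Num.min T (s + r).
  have mm : Num.max 0 (s - r) < Num.min T (s + r).
    by move: sT; rewrite in_itv/= gt_max !lt_min; lra.
  by have [q] := rat_in_itvoo mm; rewrite in_itv/=; exists q.
move: qP; rewrite gt_max lt_min => qP.
have qT : ratr q \in `[0, T] by rewrite in_itv/=; lra.
have /rP/(_ qT) : `|s - ratr q| < r by rewrite ltr_norml; lra.
by rewrite /from_subspace/= fq// ltxx.
Qed.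

(** The null set on which the prescribed values fail may depend on the time;
    countably many times are enough by continuity. *)
Lemma ae_tder_eq0 (disp : measure_display) (X : measurableType disp)
    (mu : {measure set X -> \bar R}) (G : set X) (T : R)
    (f : X -> R -> R) (g : X -> R) : 0 < T ->
  (forall t, t \in `[0, T] -> {ae mu, forall x, G x -> f x t = g x}) ->
  (forall x t, G x -> t \in `[0, T] -> tderivable T (f x) t) ->
  {ae mu, forall x, G x -> forall t, t \in `[0, T] -> tder T (f x) t = 0}.
Proof.
move=> T0 fg df.
have : {ae mu, forall x, forall k,
    if unpickle k is Some q then (ratr q : R) \in `[0, T] -> G x -> f x (ratr q) = g x
    else True}.
  apply: ae_foralln => k; case: (unpickle k) => [q|]; last exact: aeW.
  have [qT|qT] := boolP ((ratr q : R) \in `[0, T]); last exact: aeW.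
  by apply: filterS (fg _ qT) => x fgx _.
apply: filterS => x fgx Gx t tT; apply: tder_eq => //.
apply: (@eq_is_tder _ _ (cst (g x))) => //; last exact: is_tder_cst.
have h := @continuous_rat_eq T (f x) (g x) T0
  (tder_continuous (fun t tT => df x t Gx tT)).
move=> s sT; rewrite h// => q qT.
by have := fgx (pickle q); rewrite pickleK => /(_ qT Gx).
Qed.

Section green.
Context (d : nat) (Om : set 'rV[R]_d).

Lemma within_closure_proper (A : set 'rV[R]_d) x : closure A x ->
  ProperFilter (within A (nbhs x)).
Proof.
by move=> clAx; apply: Build_ProperFilter_ex => P /clAx[y [Ay APy]]; exists y; apply: APy.
Qed.

(** The boundary integrand vanishes where either factor does. *)
Lemma Green_formula_eq0 (n F : 'rV[R]_d -> 'rV[R]_d) (v : 'rV[R]_d -> R) :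
  Green_formula Om n F v ->
  {ae Surf, forall x, boundary Om x ->
    v x = 0 \/ dot (F y) (n x) @[y --> within Om (nbhs x)] --> (0 : R)} ->
  \int[Leb]_(x in Om) (divergence F x * v x + dot (F x) (grad v x)) = 0.
Proof.
move=> [_ _ _ ->] vF; apply: ae_zero_Rintegral.
  exact: measure_is_complete_caratheodory.
apply: filterS vF => x vF bx; have [clx _] := bx.
have ? := within_closure_proper clx.
have [->|F0] := vF bx; first by rewrite mul0r.
by rewrite /normal_trace (cvg_lim _ F0) ?mulr0//.
Qed.

(** The Neumann condition concerns the undamaged stress; the degradation factor
    [w] is between 0 and 1, so that it preserves the limit 0 whether or not
    it converges. *)
Lemma dot_degraded_stress_cvg0 (n : 'rV[R]_d) (w : 'rV[R]_d -> R)
    (S : 'rV[R]_d -> 'M[R]_d) (x : 'rV[R]_d) i :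
  (forall y, Om y -> 0 <= w y <= 1) ->
  n *m (S y)^T @[y --> within Om (nbhs x)] --> (0 : 'rV[R]_d) ->
  dot (row i (w y *: S y)) n @[y --> within Om (nbhs x)] --> (0 : R).
Proof.
move=> w01 nS.
have nSi : (n *m (S y)^T) 0 i @[y --> within Om (nbhs x)] --> (0 : 'rV[R]_d) 0 i.
  apply: (@cvg_comp _ _ _ (fun y => n *m (S y)^T) (fun M : 'rV[R]_d => M 0 i) _ _ _ nS).
  exact: coord_continuous.
rewrite [X in _ --> X]mxE in nSi.
apply/cvgrPdist_lt => e e0; have /cvgrPdist_lt/(_ _ e0) nSe := nSi.
apply: filterS2 (near_withinT Om (nbhs_filter x)) nSe => y Omy.
rewrite !sub0r !normrN; apply: le_lt_trans.
have -> : dot (row i (w y *: S y)) n = w y * (n *m (S y)^T) 0 i.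
  rewrite mxE mulr_sumr; apply: eq_bigr => k _; rewrite !mxE; ring.
have /andP[w0 w1] := w01 y Omy.
by rewrite normrM ler_piMl// ger0_norm.
Qed.

End green.
End boundary_terms.

(** * Elasticity and the energy densities *)

Section stress_strain.
Context (R : realType) (d : nat) (mu lambda aL Theta0 : R) (Theta : 'rV[R]_d -> R).
Implicit Types (w : 'rV[R]_d -> 'rV[R]_d) (x : 'rV[R]_d) (P : 'M[R]_d).

Local Notation strain_star := (strain_star aL Theta0 Theta).
Local Notation stress_star := (stress_star mu lambda aL Theta0 Theta).

Lemma strain_starE w x i j : strain_star w x i j =
  2^-1 * (pder j (fun y => w y 0 i) x + pder i (fun y => w y 0 j) x)
  - aL * (Theta x - Theta0) * (i == j)%:R.
Proof. by rewrite !mxE mulr_natr. Qed.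

Lemma strain_star_sym w x i j : strain_star w x i j = strain_star w x j i.
Proof. by rewrite !strain_starE eq_sym [X in 2^-1 * X]addrC. Qed.

(** The choice of [beta] makes the thermal stress the image of the thermal
    strain under Hooke's law, so that the stress is a symmetric linear function
    of the elastic strain alone. *)
Lemma stress_star_Hooke w x : stress_star w x =
  (lambda * \tr (strain_star w x)) *: 1%:M + (2 * mu) *: strain_star w x.
Proof.
have -> : \tr (strain_star w x) = divergence w x - d%:R * (aL * (Theta x - Theta0)).
  rewrite /mxtrace; under eq_bigr do rewrite strain_starE eqxx mulr1.
  rewrite big_split/= sumr_const card_ord mulr_natl mulNrn; congr (_ - _).
  by apply: eq_bigr => i _; field.
rewrite /stress_star /stress /strain_star.
by apply/matrixP => i j; rewrite /beta !mxE; ring.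
Qed.

Lemma ddot_stress_star w x P : ddot (stress_star w x) P =
  lambda * \tr (strain_star w x) * \tr P + 2 * mu * ddot (strain_star w x) P.
Proof.
rewrite stress_star_Hooke; move: (strain_star w x) => e; rewrite /ddot [\tr P]/mxtrace.
rewrite [_ * \sum_i P i i]mulr_sumr [2 * mu * _]mulr_sumr.
rewrite -big_split/=; apply: eq_bigr => i _.
rewrite (bigD1 i)//= [in RHS](bigD1 i)//= mulrDr addrA; congr (_ + _).
  by rewrite !mxE eqxx/=; ring.
rewrite [RHS]mulr_sumr; apply: eq_bigr => j /negbTE ji.
by rewrite !mxE eq_sym ji/=; ring.
Qed.

(** The stress is symmetric, so that it only sees the symmetric part of [P]. *)
Lemma ddot_stress_star_sym w x P :
  ddot (stress_star w x) (2^-1 *: (P + P^T)) = ddot (stress_star w x) P.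
Proof.
rewrite !ddot_stress_star [\tr (_ *: (P + _))]mxtraceZ [\tr (P + _)]mxtraceD mxtrace_tr.
have -> : 2^-1 * (\tr P + \tr P) = \tr P by field.
congr (_ + _ * _); rewrite /ddot.
have sw : \sum_i \sum_j strain_star w x i j * P j i =
          \sum_i \sum_j strain_star w x i j * P i j.
  rewrite exchange_big/=; apply: eq_bigr => i _; apply: eq_bigr => j _.
  by rewrite strain_star_sym.
transitivity (2^-1 * (\sum_i \sum_j strain_star w x i j * P i j +
                      \sum_i \sum_j strain_star w x i j * P j i)).
  rewrite -big_split mulr_sumr; apply: eq_bigr => i _.
  rewrite -big_split mulr_sumr; apply: eq_bigr => j _.
  by rewrite !mxE /=; ring.
by rewrite sw; field.
Qed.

End stress_strain.

Lemma eq_weighted_field (R : realType) disp (X : measurableType disp) (D : set X)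
    (T : R) (w : X -> R) (f g df dg : X -> R -> R) :
  (forall x t, f x t = g x t) -> (forall x t, df x t = dg x t) ->
  weighted_field D T w f df -> weighted_field D T w g dg.
Proof.
move=> fg dfg fdf.
have <- : f = g by apply/funext => x; apply/funext => t; exact: fg.
have <- : df = dg by apply/funext => x; apply/funext => t; exact: dfg.
exact: fdf.
Qed.

Section energy_densities.
Context (R : realType) (d : nat) (Om : set 'rV[R]_d) (T : R).
Variables (mu lambda aL Theta0 eps gamma : R) (Theta : 'rV[R]_d -> R).
Variables (u : 'rV[R]_d -> R -> 'rV[R]_d) (z : 'rV[R]_d -> R -> R).

Hypothesis oOm : open Om.
Hypothesis bOm : bounded_set Om.
Hypothesis L2Theta : in_L2 Leb Om Theta.
Hypothesis uC1 : forall i, C1_field Om T (fun x t => u x t 0 i).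
Hypothesis zC1 : C1_field Om T z.

Local Notation strain_star t := (strain_star aL Theta0 Theta (u^~ t)).
Local Notation stress_star t := (stress_star mu lambda aL Theta0 Theta (u^~ t)).

(* The elastic strain grows like [weight], because [Theta] enters it linearly;
   the elastic energy density, quadratic in the strain, grows like
   [weight ^ 2], which the integrable function [weight2] dominates. *)
Let weight (x : LT R d) : R := 1 + `|Theta x|.
Let weight2 (x : LT R d) : R := 2 + 2 * ((Theta \_ Om) x ^+ 2).

Definition grad_vec_rate (x : 'rV[R]_d) (t : R) : 'M[R]_d :=
  \matrix_(i, j) tder T (fun s => pder j (fun y => u y s 0 i) x) t.

Let weight0 x : 0 <= weight x. Proof. by rewrite addr_ge0. Qed.

Let weight_ge1 (x : LT R d) : Om x -> (cst 1 : LT R d -> R) x <= weight x.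
Proof. by move=> _; rewrite /= /weight lerDl. Qed.

Let measurable_Theta : measurable_fun (Om : set (LT R d)) Theta.
Proof.
have mT : measurable_fun [set: LT R d] (Theta \_ Om) by have /andP[/set_mem] := L2Theta.
apply: (@eq_measurable_fun _ _ (LT R d : measurableType _) R (Om : set (LT R d)) (Theta \_ Om)).
  by move=> x xOm; rewrite patchE xOm.
exact: (measurable_funS measurableT (@subsetT _ _) mT).
Qed.

Lemma Leb_weight2_integrable :
  (Leb : {measure set (LT R d) -> \bar R}).-integrable Om (EFin \o weight2).
Proof.
have mOm := measurable_open oOm.
have iT : (Leb : {measure set (LT R d) -> \bar R}).-integrable Om
    (fun x => ((Theta \_ Om) x ^+ 2)%:E).
  exact: (integrableS measurableT mOm (@subsetT _ _) (Lfun2_integrable_sqr L2Theta)).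
have i2 : (Leb : {measure set (LT R d) -> \bar R}).-integrable Om (EFin \o cst 2).
  apply: measurable_bounded_integrable => //; first exact: Leb_bounded.
  by exists 2; split => // K K2 x _ /=; rewrite ger0_norm// ltW.
exact: (integrableD mOm i2 (integrableZl mOm 2 iT)).
Qed.

Lemma strain_star_field i j : weighted_field (Om : set (LT R d)) T weight
  (fun x t => strain_star t x i j)
  (fun x t => (2^-1 *: (grad_vec_rate x t + (grad_vec_rate x t)^T)) i j).
Proof.
have pij k l := weighted_fieldW weight_ge1 (C1_pder_weighted_field l oOm bOm (uC1 k)).
have thermal : weighted_field (Om : set (LT R d)) T weight
    (fun x _ => - (aL * (Theta x - Theta0) * (i == j)%:R)) (fun _ _ => 0).
  have Th0 : weighted_field (Om : set (LT R d)) T weight (fun x _ => Theta x) (fun _ _ => 0).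
    apply: weighted_field_stationary => // x _.
    by rewrite /weight lerDr.
  have c1 : weighted_field (Om : set (LT R d)) T weight (fun x _ => 1) (fun _ _ => 0).
    by apply: weighted_field_stationary => // x Omx; rewrite normr1 weight_ge1.
  apply: eq_weighted_field (weighted_fieldZ (- (aL * (i == j)%:R))
    (weighted_fieldD Th0 (weighted_fieldZ (- Theta0) c1))) => x t /=; ring.
apply: eq_weighted_field (weighted_fieldD
  (weighted_fieldZ 2^-1 (weighted_fieldD (pij i j) (pij j i))) thermal) => x t.
  by rewrite strain_starE.
by rewrite !mxE addr0.
Qed.

(** The elastic energy density is a quadratic form in the elastic strain, so
    its rate is twice the stress tested with the strain rate. *)
Lemma W_star_field : weighted_field (Om : set (LT R d)) T (fun x => weight x * weight x)
  (fun x t => ddot (stress_star t x) (strain_star t x))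
  (fun x t => 2 * ddot (stress_star t x) (grad_vec_rate x t)).
Proof.
pose E' x t := 2^-1 *: (grad_vec_rate x t + (grad_vec_rate x t)^T).
have w0 (x : LT R d) : Om x -> 0 <= weight x * weight x by move=> _; rewrite mulr_ge0.
have trF := weighted_field_sum (index_enum 'I_d) (fun x _ => weight0 x)
  (fun i => strain_star_field i i).
have sqF := weighted_field_sum (index_enum 'I_d) w0 (fun i =>
  weighted_field_sum (index_enum 'I_d) w0 (fun j =>
    weighted_fieldM (strain_star_field i j) (strain_star_field i j))).
apply: eq_weighted_field (weighted_fieldD
  (weighted_fieldZ lambda (weighted_fieldM trF trF)) (weighted_fieldZ (2 * mu) sqF)) => x t.
  by rewrite ddot_stress_star mulrA.
rewrite -ddot_stress_star_sym ddot_stress_star -/(E' x t) /mxtrace /ddot.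
rewrite [RHS]mulrDr; congr (_ + _); first by ring.
rewrite [RHS]mulrCA; congr (_ * _); rewrite [RHS]mulr_sumr; apply: eq_bigr => i _.
by rewrite [RHS]mulr_sumr; apply: eq_bigr => j _; rewrite -/(E' x t); ring.
Qed.

Lemma elastic_density_field : weighted_field (Om : set (LT R d)) T weight2
  (fun x t => (1 - z x t) ^+ 2 * ddot (stress_star t x) (strain_star t x))
  (fun x t => - (2 * (1 - z x t) * tder T (z x) t *
                 ddot (stress_star t x) (strain_star t x))
    + 2 * ((1 - z x t) ^+ 2 * ddot (stress_star t x) (grad_vec_rate x t))).
Proof.
have one : weighted_field (Om : set (LT R d)) T (cst 1) (fun x _ => 1) (fun _ _ => 0).
  by apply: weighted_field_stationary => // x Omx; rewrite normr1.
have h := weighted_fieldD one (weighted_fieldZ (-1) (C1_weighted_field oOm bOm zC1)).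
apply: weighted_fieldW; last first.
  apply: eq_weighted_field (weighted_fieldM (weighted_fieldM h h) W_star_field) => x t;
  by ring.
(* [(1 + a) ^ 2 <= 2 + 2 a ^ 2]. *)
move=> x Omx /=; rewrite /weight2 /weight patchE mem_set//.
by rewrite -real_normK ?num_real//; have := sqr_ge0 (1 - `|Theta x|); nra.
Qed.

Lemma damage_density_field : weighted_field (Om : set (LT R d)) T weight2
  (fun x t => gamma * (eps * enorm (grad (z^~ t) x) ^+ 2 + `|z x t| ^+ 2 / eps))
  (fun x t => gamma * (eps * (2 * \sum_j (grad (z^~ t) x 0 j *
     tder T (fun s => pder j (z^~ s) x) t)) + 2 * z x t * tder T (z x) t / eps)).
Proof.
have zF := C1_weighted_field oOm bOm zC1.
have zj j := C1_pder_weighted_field j oOm bOm zC1.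
have w0 (x : LT R d) : Om x -> 0 <= (cst 1 x * cst 1 x : R).
  by move=> _ /=; rewrite mulr1.
have sqF := weighted_field_sum (index_enum 'I_d) w0
  (fun j => weighted_fieldM (zj j) (zj j)).
apply: weighted_fieldW; last first.
  apply: eq_weighted_field (weighted_fieldZ gamma (weighted_fieldD
    (weighted_fieldZ eps sqF) (weighted_fieldZ eps^-1 (weighted_fieldM zF zF)))) => x t.
    rewrite /enorm sqr_sqrtr; last by apply: sumr_ge0 => j _; rewrite -expr2 sqr_ge0.
    rewrite real_normK ?num_real// expr2 [_ / eps]mulrC; congr (_ * (_ * _ + _)).
    by apply: eq_bigr => j _; rewrite !mxE.
  congr (_ * (_ * _ + _)); last by ring.
  by rewrite [RHS]mulr_sumr; apply: eq_bigr => j _; rewrite !mxE; ring.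
move=> x Omx /=; rewrite mulr1 /weight2.
by have := sqr_ge0 ((Theta \_ Om) x); lra.
Qed.

(** At every point the rate of the energy density is the dissipation
    [- alpha * `|v| ^+ 2] plus the two integrands of Green's formula. Hooke's
    law being symmetric, the stress power is [S : grad v]; the positive part in
    the damage equation enters only through [alpha * v ^+ 2 = X * v], which
    holds for [alpha * v = Num.max X 0] whatever the sign of [X]. *)
Lemma energy_density_rate (alpha : R) x t :
  let S y := degraded_stress mu lambda aL Theta0 Theta (u^~ t) (z^~ t) y in
  let q y := gamma *: grad (z^~ t) y in
  let vu i y := tder T (fun s => u y s 0 i) t in
  let vz y := tder T (z y) t in
  0 < T -> 0 < eps -> 0 < alpha -> Om x -> t \in `[0, T] ->
  row_divergence S x = 0 ->
  alpha * vz x = Num.max (eps * divergence q x - gamma / eps * z x t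
    + (1 - z x t) * W_star mu lambda aL Theta0 Theta (u^~ t) x) 0 ->
  2^-1 * (- (2 * (1 - z x t) * vz x * ddot (stress_star t x) (strain_star t x))
    + 2 * ((1 - z x t) ^+ 2 * ddot (stress_star t x) (grad_vec_rate x t)))
  + 2^-1 * (gamma * (eps * (2 * \sum_j (grad (z^~ t) x 0 j *
      tder T (fun s => pder j (z^~ s) x) t)) + 2 * z x t * vz x / eps)) =
  - alpha * `|vz x| ^+ 2 +
  (\sum_i (divergence (fun y => row i (S y)) x * vu i x
     + dot (row i (S x)) (grad (vu i) x))
   + eps * (divergence q x * vz x + dot (q x) (grad vz x))).
Proof.
move=> S q vu vz T0 eps0 alpha0 Omx tT divS vzE.
have -> : \sum_i (divergence (fun y => row i (S y)) x * vu i x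
     + dot (row i (S x)) (grad (vu i) x)) =
   (1 - z x t) ^+ 2 * ddot (stress_star t x) (grad_vec_rate x t).
  rewrite /ddot mulr_sumr; apply: eq_bigr => i _.
  have /rowP/(_ i) := divS; rewrite !mxE => ->.
  rewrite mul0r add0r /dot mulr_sumr; apply: eq_bigr => j _.
  rewrite [row i _ _ _]mxE [grad _ _ _ _]mxE [grad_vec_rate _ _ _ _]mxE.
  rewrite (pder_tder j T0 oOm (uC1 i) Omx tT) {1}/S /degraded_stress [in LHS]mxE.
  by rewrite mulrA.
have -> : dot (q x) (grad vz x) = gamma * \sum_j (grad (z^~ t) x 0 j *
      tder T (fun s => pder j (z^~ s) x) t).
  rewrite /dot mulr_sumr; apply: eq_bigr => j _.
  by rewrite [grad vz _ _ _]mxE (pder_tder j T0 oOm zC1 Omx tT) [q _ _ _]mxE mulrA.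
move: vzE; rewrite /W_star; set X := (X in Num.max X 0) => vzE.
have dissip : alpha * `|vz x| ^+ 2 = X * vz x.
  rewrite real_normK ?num_real// expr2 mulrA vzE.
  have [//|X0] := leP 0 X.
  have v0 : vz x = 0.
    move: vzE; rewrite (max_idPr (ltW X0)) => /eqP.
    by rewrite mulf_eq0 gt_eqF//= => /eqP.
  by rewrite v0 !mulr0.
rewrite mulNr dissip /X; field.
by rewrite gt_eqF.
Qed.

End energy_densities.

(** * The energy equality *)

Unset Implicit Arguments.

Theorem theorem3p2 (R : realType) (d : nat) (hd : d = 2%N \/ d = 3%N)
  (Om GD GN : set 'rV[R]_d) (n : 'rV[R]_d -> 'rV[R]_d) (T : R)
  (mu lambda aL Theta0 alpha eps gamma : R)
  (uD : 'rV[R]_d -> 'rV[R]_d) (Theta zstar : 'rV[R]_d -> R)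
  (u : 'rV[R]_d -> R -> 'rV[R]_d) (z : 'rV[R]_d -> R -> R)
  (hOm : bounded_domain Om)
  (hn : {ae Surf, forall x, boundary Om x -> outward_unit_normal Om x (n x)})
  (hGU : GD `|` GN = boundary Om) (hGI : GD `&` GN = set0)
  (hGD : (0 < Surf GD)%E)
  (hT : 0 < T)
  (hmu : 0 < mu) (hlambda : - (2 * mu / d%:R) < lambda) (haL : 0 < aL)
  (hTheta0 : 0 < Theta0) (halpha : 0 < alpha) (heps : 0 < eps)
  (hgamma : 0 < gamma)
  (huD : forall i, in_H12 Om GD (fun x => uD x 0 i))
  (hTheta : in_L2 Leb Om Theta)
  (hz01 : forall x t, closure Om x -> t \in `[0, T] -> 0 <= z x t <= 1)
  (hsmooth : sufficiently_smooth Om T n mu lambda aL Theta0 gamma Theta u z)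
  (equ : forall x t, Om x -> t \in `[0, T] ->
    - row_divergence
        (fun y => (1 - z y t) ^+ 2 *:
                  stress_star mu lambda aL Theta0 Theta (u^~ t) y) x = 0)
  (eqz : forall x t, Om x -> t \in `[0, T] ->
    alpha * tder T (z x) t =
    Num.max
      (eps * divergence (fun y => gamma *: grad (z^~ t) y) x
       - gamma / eps * z x t
       + (1 - z x t) * W_star mu lambda aL Theta0 Theta (u^~ t) x) 0)
  (bcD : forall t, t \in `[0, T] ->
    {ae Surf, forall x, GD x -> u x t = uD x})
  (bcN : forall t, t \in `[0, T] ->
    {ae Surf, forall x, GN x ->
      n x *m (stress_star mu lambda aL Theta0 Theta (u^~ t) y)^T
        @[y --> within Om (nbhs x)] --> (0 : 'rV[R]_d)})
  (bcz : forall t, t \in `[0, T] ->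
    {ae Surf, forall x, boundary Om x ->
      dot (grad (z^~ t) y) (n x) @[y --> within Om (nbhs x)] --> (0 : R)})
  (hz0 : forall x, Om x -> z x 0 = zstar x) :
  forall t, t \in `[0, T] ->
    is_tder T
      (fun s => E_el mu lambda aL Theta0 Theta Om (u^~ s) (z^~ s)
                + E_s Om gamma eps (z^~ s)) t
      (- alpha * \int[Leb]_(x in Om) `|tder T (z x) t| ^+ 2)
    /\ - alpha * \int[Leb]_(x in Om) `|tder T (z x) t| ^+ 2 <= 0.
Proof.
have [oOm _ _ bOm] := hOm.
have [[uC1 zC1] _ green] := hsmooth.
have mOm := measurable_open oOm.
move=> t tT; split; last first.
  rewrite mulNr oppr_le0; apply: mulr_ge0; first exact: ltW.
  by apply: Rintegral_ge0 => x _; rewrite exprn_ge0.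
have [greenu greenz] := green t tT.
pose v i x : R := tder T (fun s => u x s 0 i) t.
pose S x := degraded_stress mu lambda aL Theta0 Theta (u^~ t) (z^~ t) x.
pose q x := gamma *: grad (z^~ t) x.
pose dz x := tder T (z x) t.
pose W x := W_star mu lambda aL Theta0 Theta (u^~ t) x.
(* Weak form of the momentum balance, tested with the velocity. *)
have bulku i : \int[Leb]_(x in Om) (divergence (fun y => row i (S y)) x * v i x
    + dot (row i (S x)) (grad (v i) x)) = 0.
  apply: (Green_formula_eq0 (greenu i)).
  have clGD x : GD x -> closure Om x.
    by move=> GDx; have [] : boundary Om x by rewrite -hGU; left.
  have vGD : {ae Surf, forall x, GD x -> forall s, s \in `[0, T] ->
      tder T ((fun x s => u x s 0 i) x) s = 0}.
    apply: (@ae_tder_eq0 R _ _ (@Surf R d) GD T (fun x s => u x s 0 i)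
      (fun x => uD x 0 i) hT) => [s sT|x s GDx sT].
      by apply: filterS (bcD s sT) => x uux /uux ->.
    by have [_ dui _ _] := uC1 i; apply: dui => //; exact: clGD.
  apply: filterS2 vGD (bcN t tT) => x vx Nx; rewrite -hGU => -[GDx|GNx].
    by left; exact: vx.
  right; apply: dot_degraded_stress_cvg0 (Nx GNx) => y Omy.
  have /andP[z0 z1] := hz01 y t (subset_closure Omy) tT.
  by rewrite exprn_ge0 ?subr_ge0// exprn_ile1 ?subr_ge0// gerBl.
(* The same for the damage flux, tested with the damage rate. *)
have bulkz : \int[Leb]_(x in Om) (divergence q x * dz x + dot (q x) (grad dz x)) = 0.
  apply: (Green_formula_eq0 greenz).
  apply: filterS (bcz t tT) => x zx bx; right.
  have dotq y : dot (q y) (n x) = gamma * dot (grad (z^~ t) y) (n x).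
    by rewrite /dot mulr_sumr; apply: eq_bigr => j _; rewrite !mxE; ring.
  have -> : (fun y => dot (q y) (n x)) = (fun y => gamma * dot (grad (z^~ t) y) (n x)).
    exact/funext.
  have := cvgM (@cvg_cst _ gamma _ (within Om (nbhs x)) _) (zx bx).
  by rewrite mulr0; apply.
have Fel := elastic_density_field mu lambda aL Theta0 oOm bOm hTheta uC1 zC1.
have Fs := damage_density_field eps gamma Theta oOm bOm zC1.
have iw := Leb_weight2_integrable oOm bOm hTheta.
have Fel2 := weighted_fieldZ 2^-1 Fel.
have Fs2 := weighted_fieldZ 2^-1 Fs.
have := is_tder_weighted_field mOm iw (weighted_fieldD Fel2 Fs2) tT.
pose gu i x := divergence (fun y => row i (S y)) x * v i x
  + dot (row i (S x)) (grad (v i) x).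
pose gz x := divergence q x * dz x + dot (q x) (grad dz x).
rewrite (@eq_Rintegral _ _ _ Leb Om (fun x => - alpha * `|dz x| ^+ 2 +
    (\sum_i gu i x + eps * gz x))); last first.
  move=> x /set_mem Omx.
  have divS : row_divergence S x = 0.
    by apply/eqP; rewrite -oppr_eq0; apply/eqP; exact: equ.
  exact: (energy_density_rate oOm uC1 zC1 hT heps halpha Omx tT divS (eqz x t Omx tT)).
have igz : Leb.-integrable Om (EFin \o gz) by have [] := greenz.
have igu i : Leb.-integrable Om (EFin \o gu i) by have [] := greenu i.
have isq := C1_tder_integrable_sqr oOm bOm zC1 tT.
have [isum sum0] := Rintegral_sum_eq0 mOm (index_enum 'I_d) igu bulku.
have iZ (c : R) (g : 'rV[R]_d -> R) : Leb.-integrable Om (EFin \o g) ->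
    Leb.-integrable Om (EFin \o (fun x => c * g x)).
  exact: integrableZl.
rewrite RintegralD//; [|exact: iZ|exact: (integrableD mOm isum (iZ eps _ igz))].
rewrite RintegralD//; [|exact: iZ].
rewrite sum0 !RintegralZl// bulkz mulr0 !addr0.
(* The two energies are separate integrals, the density is their sum. *)
apply: eq_is_tder => // s sT.
rewrite RintegralD//; [|exact: weighted_field_integrable iw Fel2 sT|
  exact: weighted_field_integrable iw Fs2 sT].
rewrite RintegralZl//; last exact: weighted_field_integrable iw Fel sT.
by rewrite RintegralZl//; exact: weighted_field_integrable iw Fs sT.
Qed.
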